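(* Let $p\ge2$ be an integer, $\mu\ge0$, $C>0$, $s>0$, $x_0\in\mathbb{R}^n$. Let $h:\mathbb{R}^n\to\mathbb{R}$ be $1$-uniformly convex of order $p$, and let $f:\mathbb{R}^n\to\mathbb{R}$ be $\mu$-uniformly convex (possibly $\mu=0$) with respect to $h$ and $\frac{(p-1)!}{s}$-smooth of order $p-1$, with a minimizer $x^*$. The solution $(X,Z)$ on $[0,\infty)$ to the unified accelerated tensor flow $$\dot X=\frac pt\operatorname{cothc}_p\left(C^{1/p}\mu^{1/p}t\right)(Z-X),$$ $$\frac{d}{dt}\nabla h(Z)=Cpt^{p-1}\operatorname{tanhc}_p^{p-1}\left(C^{1/p}\mu^{1/p}t\right)\left(\mu\nabla h(X)-\mu\nabla h(Z)-\nabla f(X)\right)\qquad(t>0)$$ with $X(0)=Z(0)=x_0$ satisfies, for all $t>0$, $$f(X(t))-f(x^* )\le\frac{1}{Ct^p\operatorname{sinhc}_p^p\left(C^{1/p}\mu^{1/p}t\right)}D_h(x^*,x_0).$$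
   Context: $\sinh_p:[0,\infty)\to\mathbb{R}$ is the solution of $\sinh_p'(t)=\cosh_p(t):=(1+\sinh_p^p(t))^{1/p}$, $\sinh_p(0)=0$. $\operatorname{sinhc}_p(x)=\sinh_p(x)/x$ for $x\neq0$, $\operatorname{sinhc}_p(0)=1$; $\operatorname{tanhc}_p=\operatorname{sinhc}_p/\cosh_p$; $\operatorname{cothc}_p=1/\operatorname{tanhc}_p$. The functions $f,h$ are continuously differentiable ($f$ also $p-1$ times differentiable). $D_g(y,x)=g(y)-g(x)-\langle\nabla g(x),y-x\rangle$. $h$ is $1$-uniformly convex of order $p$ if $D_h(y,x)\ge\frac1p\|y-x\|^p$ for all $x,y$. $f$ (convex) is $\mu$-uniformly convex with respect to $h$ if $D_f(x,y)\ge\mu D_h(x,y)$ for all $x,y$. $f$ is $L$-smooth of order $p-1$ if $\|\nabla^{p-1}f(y)-\nabla^{p-1}f(x)\|\le L\|y-x\|$ for all $x,y$. A solution has $X$, $Z$ continuous on $[0,\infty)$ and $C^1$ in the sense required by the system. *)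

(* Defs.v *)
From mathcomp Require Import all_boot all_order all_algebra.
From mathcomp Require Import all_classical all_reals all_analysis.

Set Implicit Arguments.
Unset Strict Implicit.
Unset Printing Implicit Defensive.

Import Order.TTheory GRing.Theory Num.Theory.
Import numFieldNormedType.Exports.

Local Open Scope classical_set_scope.
Local Open Scope ring_scope.

Section GeneralizedHyperbolic.
Context {R : realType}.
Implicit Types (p : nat) (S : R -> R) (x : R).

(* [S] solves [S' = (1 + S ^ p) ^ (1 / p)], [S 0 = 0] on the half-line, the
   derivative at [0] being one-sided. Values at negative arguments are
   unconstrained and never used. *)
Definition sinhp_ivp p S : Prop :=
  [/\ S 0 = 0,
      (S t - S 0) / t @[t --> 0^'+] --> (1 + S 0 ^+ p) `^ p%:R^-1 &
      forall t : R, 0 < t -> is_derive t 1 S ((1 + S t ^+ p) `^ p%:R^-1)].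

Definition sinhp p : R -> R := xget (fun=> 0) [set S | sinhp_ivp p S].

Definition coshp p x : R := (1 + sinhp p x ^+ p) `^ p%:R^-1.

Definition sinhc p x : R := if x == 0 then 1 else sinhp p x / x.

Definition tanhc p x : R := sinhc p x / coshp p x.

Definition cothc p x : R := (tanhc p x)^-1.

End GeneralizedHyperbolic.

(* The norm that the library puts on ['rV[R]_n] is the sup norm, so the
   Euclidean structure is defined here; differentiability and continuity do not
   depend on this choice. *)
Section Euclidean.
Context {R : realType} {n : nat}.
Local Notation V := 'rV[R]_n.
Implicit Types (u v x y : V) (f g h : V -> R).

Definition dot u v : R := \sum_i u 0 i * v 0 i.

Definition enorm u : R := Num.sqrt (dot u u).

Definition grad g x : V := \row_i 'd g x (delta_mx 0 i).

Definition continuously_differentiable g : Prop :=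
  (forall x, differentiable g x) /\ continuous (grad g).

(* In finite dimension, [g] is [k.+1] times (Frechet) differentiable iff it is
   differentiable and each [x |-> 'd g x v] is [k] times differentiable. *)
Fixpoint times_differentiable (k : nat) g : Prop :=
  if k is k'.+1 then
    (forall x, differentiable g x) /\
    (forall v, times_differentiable k' (fun x => 'd g x v))
  else True.

(* The k-th derivative as a k-linear form: [nabla g x (v1, ..., vk)] is
   D^k g(x)[v1, ..., vk]. *)
Definition nabla (k : nat) g x (vs : k.-tuple V) : R :=
  foldr (fun v g' => fun z => 'd g' z v) g vs x.

(* Operator norm; the value is extended-real so that it is meaningful for every
   [T], multilinear or not. *)
Definition tensor_norm (k : nat) (T : k.-tuple V -> R) : \bar R :=
  ereal_sup [set `|T vs|%:E | vs in
    [set vs : k.-tuple V | forall i, enorm (tnth vs i) <= 1]].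

Definition smooth_of_order (k : nat) (L : R) f : Prop :=
  forall x y,
    (tensor_norm (fun vs : k.-tuple V => (nabla f y vs - nabla f x vs)%R)
     <= (L * enorm (y - x))%:E)%E.

Definition bregman g y x : R := g y - g x - dot (grad g x) (y - x).

Definition uniformly_convex (sigma : R) (p : nat) h : Prop :=
  forall x y, sigma / p%:R * enorm (y - x) ^+ p <= bregman h y x.

Definition relatively_uniformly_convex (mu : R) h f : Prop :=
  convex_function [set: convex_lmodType V] f /\
  forall x y, mu * bregman h x y <= bregman f x y.

(* [c] stands for C ^ (1 / p) * mu ^ (1 / p). [Z] itself need not be
   differentiable: the system only involves the derivative of grad h (Z). *)
Definition tensor_flow (p : nat) (C mu : R) f h (x0 : V) (X Z : R -> V) : Prop :=
  let c := C `^ p%:R^-1 * mu `^ p%:R^-1 in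
  [/\ {within `[0, +oo[, continuous X},
      {within `[0, +oo[, continuous Z},
      X 0 = x0 /\ Z 0 = x0,
      forall t : R, 0 < t ->
        is_derive t 1 X ((p%:R / t * cothc p (c * t)) *: (Z t - X t)) &
      forall t : R, 0 < t ->
        is_derive t 1 (fun s => grad h (Z s))
          ((C * p%:R * t ^+ p.-1 * tanhc p (c * t) ^+ p.-1) *:
           (mu *: grad h (X t) - mu *: grad h (Z t) - grad f (X t)))].

End Euclidean.

(* Main.v *)
Require Import Defs.
From mathcomp Require Import all_boot all_order all_algebra.
From mathcomp Require Import all_classical all_reals all_analysis.
From mathcomp Require Import ring lra.
Import Order.TTheory GRing.Theory Num.Theory.
Import numFieldNormedType.Exports.
Local Open Scope classical_set_scope.
Local Open Scope ring_scope.

Set Implicit Arguments.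
Unset Strict Implicit.
Unset Printing Implicit Defensive.

(** Put [c = C^(1/p) * mu^(1/p)] and [A t = C * t^p * sinhc_p(c t)^p], which is
    [C * t^p] when [mu = 0] and [sinh_p(c t)^p / mu] otherwise. Since
    [cosh_p^p = 1 + sinh_p^p] and [sinh_p' = cosh_p], the two coefficients of the
    flow are [A' / A] and [A' / (1 + mu A)] ([is_derive_scaling],
    [scaling_tanhc]). The energy
      [E t = A t * (f (X t) - f y) + (1 + mu * A t) * D_h(y, Z t)]
    is then nonincreasing for every point [y]: after substitution of the flow,
    its derivative is
      [- A' * (D_f(y, X) - mu D_h(y, X)) - A' * mu * D_h(Z, X) <= 0]
    ([energy_dissipation]). As [A 0 = 0] and [Z 0 = x0], the inequality
    [E t <= E 0 = D_h(y, x0)] bounds [A t * (f (X t) - f y)]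
    ([accelerated_flow_bound]), and [y] is taken to be the minimizer.

    Two points need more than this computation. The function [sinhp] is chosen
    among the solutions of its initial value problem, so a solution has to be
    exhibited ([autonomous_ivp], [sinhpP]). And only [grad h (Z t)], not [Z t],
    is known to be differentiable; convexity of [h] still makes [D_h(y, Z t)]
    differentiable, with the derivative given by the formal chain rule
    ([is_derive_bregman]). *)

(** * Generalized hyperbolic functions *)

(** The increment [h *: 1] of a derivative along [1] becomes [h], the form in
    which difference quotients are compared below. *)
Lemma is_derive1_cvgP (R : numFieldType) (V : normedModType R) (f : R -> V)
    (t : R) (v : V) :
  is_derive t 1 f v <->
  h^-1 *: (f (h + t) - f t) @[h --> 0^'] --> v.
Proof.
have e : (fun h : R => h^-1 *: (f (h + t) - f t)) =
         (fun h : R => h^-1 *: ((f \o shift t) (h *: 1) - f t)).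
  by apply/funext => h /=; rewrite /GRing.scale/= mulr1.
rewrite e; split => [[df <-]|fv]; first exact: df.
by apply: DeriveDef; [apply/cvg_ex; exists v | exact: cvg_lim].
Qed.

(** Separation of variables: [S] is the inverse of
    [x |-> \int_0^x du / phi u]. The linear bound on [phi] makes this primitive
    dominate [ln (1 + x)], hence reach every [t >= 0]: the solution does not
    blow up in finite time. *)
Lemma autonomous_ivp (R : realType) (phi : R -> R) :
  continuous phi -> (forall y : R, 0 < phi y) ->
  (forall y : R, 0 <= y -> phi y <= 1 + y) ->
  exists S : R -> R, S 0 = 0 /\
    forall t : R, 0 <= t -> 0 <= S t /\ is_derive t 1 S (phi (S t)).
Proof.
move=> phic phi_gt0 phi_le.
have rphic : continuous (fun y : R => (phi y)^-1).
  by move=> y; apply: cvgV; [exact: lt0r_neq0 | exact: phic].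
(* The integral starts at [-1] instead of [0] so that [0] is an interior point:
   [S] is then differentiable at [0], not only on the right. *)
pose F (x : R) : R := \int[lebesgue_measure]_(u in `[-1, x]) (phi u)^-1.
have dF (x : R) : -1 < x -> is_derive x 1 F (phi x)^-1.
  move=> x1.
  have [|||] := @continuous_FTC1_closed R (fun y : R => (phi y)^-1) (-1) x (x + 1)
    _ _ _ (rphic x).
  - by rewrite ltrDl.
  - apply: continuous_compact_integrable; first exact: segment_compact.
    exact: continuous_subspaceT.
  - exact: x1.
  - by move=> dF eF; apply: (DeriveDef dF); rewrite -derive1E; exact: eF.
have cF (x : R) : -1 < x -> {for x, continuous F}.
  move=> x1; apply: differentiable_continuous; apply/derivable1_diffP.
  by case: (dF _ x1).
have Fmono (x y : R) : -1 < x -> x < y -> F x < F y.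
  move=> x1 xy.
  apply: (@gtr0_derive1_incr R F x y) => //.
  - move=> z; rewrite in_itv/= => /andP[xz _].
    by have [] := dF _ (lt_trans x1 xz).
  - move=> z; rewrite in_itv/= => /andP[xz _].
    rewrite derive1E; have [_ ->] := dF _ (lt_trans x1 xz).
    by rewrite invr_gt0.
  - apply: continuous_in_subspaceT => z; rewrite inE/= in_itv/= => /andP[xz _].
    exact/cF/(lt_le_trans x1).
have Finj (x y : R) : -1 < x -> -1 < y -> F x = F y -> x = y.
  move=> x1 y1 e; case: (ltgtP x y) => // h.
  - by have := Fmono _ _ x1 h; rewrite e ltxx.
  - by have := Fmono _ _ y1 h; rewrite e ltxx.
have Fln (x : R) : 0 <= x -> ln (1 + x) <= F x - F 0.
  move=> x0.
  pose G (y : R) : R := F y - ln (1 + y).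
  have dG (y : R) : -1 < y -> is_derive y 1 G ((phi y)^-1 - (1 + y)^-1).
    move=> y1.
    have p1 : 0 < 1 + y by lra.
    have d1 : is_derive y 1 (fun z : R => 1 + z) 1.
      have := is_deriveD (is_derive_cst (1 : R) y 1) (is_derive_id y 1).
      by rewrite add0r.
    have d2 := is_derive1_comp (is_derive1_ln p1) d1.
    rewrite mulr1 in d2.
    have d3 := dF _ y1.
    exact: (is_deriveB d3 d2).
  have : G 0 <= G x.
    apply: (@ger0_derive1_ndecry R G 0) => //.
    - move=> z; rewrite in_itv/= andbT => z0.
      by have [] := dG z (lt_trans (ltrN10 _) z0).
    - move=> z; rewrite in_itv/= andbT => z0.
      rewrite derive1E; have [_ ->] := dG z (lt_trans (ltrN10 _) z0).
      rewrite subr_ge0 lef_pV2 ?posrE ?phi_gt0 //; last by lra.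
      by apply: phi_le; exact: ltW.
    - apply: continuous_in_subspaceT => z; rewrite inE/= in_itv/= andbT => z0.
      apply: differentiable_continuous; apply/derivable1_diffP.
      by have [] := dG z (lt_le_trans (ltrN10 _) z0).
  by rewrite /G addr0 ln1 subr0; lra.
pose S (t : R) : R := xget 0 [set x : R | -1 < x /\ F x - F 0 = t].
have SK (x : R) : -1 < x -> S (F x - F 0) = x.
  move=> x1; rewrite /S; case: xgetP => [y _ [y1 e]|/(_ x)/=]; last by tauto.
  by apply: Finj => //; exact: (addIr _ e).
exists S; split; first by rewrite -[in LHS](subrr (F 0)) SK// ltrN10.
move=> t t0.
(* [F (e^t) - F 0 >= ln (1 + e^t) >= t], so [e^t] is a right end for the
   intermediate value theorem. *)
have [x x0 Fx] : exists2 x, 0 <= x & F x - F 0 = t.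
  have [|||x] := @IVT R (fun x => F x - F 0) 0 (expR t) t.
  - exact: expR_ge0.
  - apply: continuous_in_subspaceT => z; rewrite inE/= in_itv/= => /andP[z0 _].
    apply: cvgB; last exact: cvg_cst.
    by apply: cF; apply: lt_le_trans z0.
  - rewrite subrr; apply/andP; split.
      by rewrite ge_min t0.
    rewrite le_max; apply/orP; right.
    apply: le_trans (Fln _ (expR_ge0 t)).
    by rewrite -[leLHS]expRK ler_ln ?posrE ?lerDr ?addr_gt0 ?expR_gt0.
  - by rewrite in_itv/= => /andP[x0 _] e; exists x.
have x1 : -1 < x by exact: lt_le_trans x0.
rewrite -Fx SK//; split => //.
rewrite -[X in is_derive _ _ _ X]invrK.
apply: (@is_derive_inverse R (fun x => F x - F 0)).
- near=> y; rewrite /cancel; apply: SK; near: y; exact: lt_nbhsr.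
- near=> y; apply: cvgB; last exact: cvg_cst.
  by apply: cF; near: y; exact: lt_nbhsr.
- rewrite -[X in is_derive _ _ _ X]subr0; apply: is_deriveB; exact: dF.
- by rewrite invr_neq0// lt0r_neq0.
Unshelve. all: by end_near. Qed.

Lemma continuous_root1X (R : realType) (p : nat) :
  continuous (fun y : R => (1 + `|y| ^+ p) `^ p%:R^-1).
Proof.
move=> y; have y1 : 0 < 1 + `|y| ^+ p by rewrite ltr_pwDl// exprn_ge0.
apply: (@continuous_comp _ _ _ (fun y : R => 1 + `|y| ^+ p)
  (fun u : R => u `^ p%:R^-1)).
  apply: cvgD; first exact: cvg_cst.
  apply: (@continuous_comp _ _ _ (fun y : R => `|y|) (fun u : R => u ^+ p)).
    exact: norm_continuous.
  exact: exprn_continuous.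
apply: differentiable_continuous; apply/derivable1_diffP.
by have [] := is_derive1_powR p%:R^-1 y1.
Qed.

Lemma root1X_le (R : realType) (p : nat) (y : R) :
  (0 < p)%N -> 0 <= y -> (1 + y ^+ p) `^ p%:R^-1 <= 1 + y.
Proof.
move=> p0 y0.
have pnz : p%:R != 0 :> R by rewrite pnatr_eq0 -lt0n.
have y1 : 0 <= 1 + y by rewrite addr_ge0.
have -> : 1 + y = ((1 + y) ^+ p) `^ p%:R^-1.
  by rewrite -powR_mulrn// -powRrM mulfV// powRr1.
apply: ge0_ler_powR; rewrite ?nnegrE ?invr_ge0 ?addr_ge0 ?exprn_ge0//.
case: p p0 {pnz} => // p _.
rewrite 2!exprS mulrDl mul1r lerD//; first by rewrite exprn_ege1// lerDl.
by rewrite ler_wpM2l// lerXn2r ?nnegrE// lerDr.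
Qed.

(** [autonomous_ivp] applies to [phi y = (1 + `|y| ^+ p) `^ p%:R^-1], which is
    positive on the whole line; the absolute value then disappears because the
    solution stays nonnegative. *)
Lemma sinhpP (R : realType) (p : nat) :
  (0 < p)%N -> sinhp_ivp p (sinhp p : R -> R).
Proof.
move=> p0; rewrite /sinhp; apply: (@xgetPex _ _ [set S | sinhp_ivp p S]) => /=.
have [|||S [S0 dS]] := @autonomous_ivp R (fun y => (1 + `|y| ^+ p) `^ p%:R^-1).
- exact: continuous_root1X.
- by move=> y; rewrite powR_gt0// ltr_pwDl// exprn_ge0.
- by move=> y y0; rewrite ger0_norm// root1X_le.
exists S; split => //.
- have [_ dS0] := dS _ (lexx 0).
  have /is_derive1_cvgP/cvg_dnbhs_at_right := dS0.
  rewrite S0 normr0; apply: cvg_trans; apply: near_eq_cvg; near=> t.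
  by rewrite addr0 mulrC.
- move=> t t0; have [St0] := dS _ (ltW t0).
  by rewrite ger0_norm.
Unshelve. all: by end_near. Qed.

Section sinhp_facts.
Context {R : realType} (p : nat) (p_gt0 : (0 < p)%N).

Lemma sinhp0 : sinhp p 0 = 0 :> R.
Proof. by have [] := sinhpP R p_gt0. Qed.

Lemma is_derive_sinhp (t : R) :
  0 < t -> is_derive t 1 (sinhp p : R -> R) (coshp p t).
Proof. by move=> t0; have [_ _] := sinhpP R p_gt0; exact. Qed.

Lemma coshp0 : coshp p 0 = 1 :> R.
Proof. by rewrite /coshp sinhp0 expr0n gtn_eqF// addr0 powR1. Qed.

Lemma sinhp_div_cvg1 : sinhp p t / t @[t --> 0^'+] --> (1 : R).
Proof.
have [S0 + _] := sinhpP R p_gt0.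
by rewrite S0 expr0n gtn_eqF// addr0 powR1; under eq_fun do rewrite subr0.
Qed.

Lemma sinhp_cvg0 : sinhp p t @[t --> 0^'+] --> (0 : R).
Proof.
rewrite -[X in _ --> X](mul1r (0 : R)).
have : (sinhp p t / t) * t @[t --> (0 : R)^'+] --> (1 * 0 : R).
  by apply: cvgM; [exact: sinhp_div_cvg1 | exact/cvg_at_right_filter/cvg_id].
apply: cvg_trans; apply: near_eq_cvg; near=> t.
by rewrite divfK// gt_eqF.
Unshelve. all: by end_near. Qed.

Lemma sinhp_continuous : {within `[0, +oo[, continuous (sinhp p : R -> R)}.
Proof.
apply/continuous_within_itvcyP; split; last by rewrite sinhp0; exact: sinhp_cvg0.
move=> t; rewrite in_itv/= andbT => t0.
apply: differentiable_continuous; apply/derivable1_diffP.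
by have [] := is_derive_sinhp t0.
Qed.

(** The initial slope [1] makes [sinhp] positive just after [0], and its
    derivative is a real power, nonnegative whatever the sign of its base: hence
    positivity persists without knowing beforehand that [1 + sinhp ^ p >= 0]. *)
Lemma sinhp_gt0 (t : R) : 0 < t -> 0 < sinhp p t.
Proof.
move=> t0.
have pos : \forall u \near (0 : R)^'+, 0 < sinhp p u / u.
  exact: (cvgr_gt 1 sinhp_div_cvg1 0 ltr01).
have : \forall u \near (0 : R)^'+, 0 < u /\ u <= t /\ 0 < sinhp p u.
  near=> u.
  have u0 : 0 < u by [].
  do !split => //; first exact/ltW.
  have : 0 < sinhp p u / u by near: u.
  by rewrite pmulr_lgt0// invr_gt0.
move=> /filter_ex[u [u0 [ut Su]]].
apply: (lt_le_trans Su).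
apply: (@ger0_derive1_ndecry R (sinhp p) 0 _ _ sinhp_continuous) => //.
- move=> z; rewrite in_itv/= andbT => z0.
  by have [] := is_derive_sinhp z0.
- move=> z; rewrite in_itv/= andbT => z0.
  by rewrite derive1E; have [_ ->] := is_derive_sinhp z0; exact: powR_ge0.
- exact: ltW.
Unshelve. all: by end_near. Qed.

Lemma sinhp_ge0 (t : R) : 0 <= t -> 0 <= sinhp p t.
Proof. by rewrite le_eqVlt => /predU1P[<-|/sinhp_gt0/ltW//]; rewrite sinhp0. Qed.

Lemma coshp_gt0 (t : R) : 0 <= t -> 0 < coshp p t.
Proof. by move=> /sinhp_ge0 S0; rewrite powR_gt0// ltr_pwDl// exprn_ge0. Qed.

(** The counterpart of [cosh ^ 2 = 1 + sinh ^ 2]. *)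
Lemma coshpX (t : R) : 0 <= t -> coshp p t ^+ p = 1 + sinhp p t ^+ p.
Proof.
move=> /sinhp_ge0 S0; rewrite -powR_mulrn ?powR_ge0// -powRrM mulVf ?powRr1//.
  by rewrite addr_ge0// exprn_ge0.
by rewrite pnatr_eq0 -lt0n.
Qed.

Lemma sinhc_gt0 (t : R) : 0 <= t -> 0 < sinhc p t.
Proof.
rewrite /sinhc; have [//|tn0] := eqVneq t 0.
by move=> t0; rewrite divr_gt0 ?sinhp_gt0// lt_def tn0.
Qed.

End sinhp_facts.

Lemma sinhpE (R : realType) (p : nat) (x : R) :
  (0 < p)%N -> sinhp p x = x * sinhc p x.
Proof.
move=> p0; rewrite /sinhc; have [->|xn0] := eqVneq x 0.
  by rewrite sinhp0// mul0r.
by rewrite mulrC divfK.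
Qed.

(** * Time scaling of the flow *)

Section scaling.
Context {R : realType} (p : nat) (C mu : R).
Context (p_gt0 : (0 < p)%N) (C_gt0 : 0 < C) (mu_ge0 : 0 <= mu).

Let c := C `^ p%:R^-1 * mu `^ p%:R^-1.

Definition scaling (t : R) : R := C * t ^+ p * sinhc p (c * t) ^+ p.

Let c_ge0 : 0 <= c.
Proof. by rewrite mulr_ge0 ?powR_ge0. Qed.

Let cX : c ^+ p = C * mu.
Proof.
have rootK (a : R) : 0 <= a -> (a `^ p%:R^-1) ^+ p = a.
  move=> a0; rewrite -powR_mulrn ?powR_ge0// -powRrM mulVf ?powRr1//.
  by rewrite pnatr_eq0 -lt0n.
by rewrite exprMn !rootK// ltW.
Qed.

Let ct_ge0 (t : R) : 0 <= t -> 0 <= c * t.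
Proof. exact: mulr_ge0. Qed.

(** With [coshpX], this makes [1 + mu * scaling t] the [p]-th power of
    [coshp p (c * t)]; it is the reason for the choice [c ^ p = C * mu]. *)
Lemma mu_scaling (t : R) : mu * scaling t = sinhp p (c * t) ^+ p.
Proof. by rewrite (sinhpE _ p_gt0) exprMn exprMn cX /scaling; ring. Qed.

Lemma scaling_gt0 (t : R) : 0 < t -> 0 < scaling t.
Proof.
move=> t0; rewrite /scaling !mulr_gt0 ?exprn_gt0//.
by apply: sinhc_gt0 => //; exact/ct_ge0/ltW.
Qed.

Lemma scaling0 : scaling 0 = 0.
Proof. by rewrite /scaling expr0n gtn_eqF// mulr0 mul0r. Qed.

Lemma scaling_cothc_gt0 (t : R) : 0 < t -> 0 < p%:R / t * cothc p (c * t).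
Proof.
move=> t0; have ct0 := ct_ge0 (ltW t0).
by rewrite mulr_gt0 ?divr_gt0 ?ltr0n// invr_gt0 divr_gt0 ?sinhc_gt0 ?coshp_gt0.
Qed.

(** Links the coefficients of the two equations of the flow: both sides are the
    derivative of [scaling], by [is_derive_scaling] below. *)
Lemma scaling_tanhc (t : R) : 0 < t ->
  (1 + mu * scaling t) * (C * p%:R * t ^+ p.-1 * tanhc p (c * t) ^+ p.-1) =
  scaling t * (p%:R / t * cothc p (c * t)).
Proof.
move=> t0; have ct0 := ct_ge0 (ltW t0).
rewrite mu_scaling -coshpX// /scaling /cothc /tanhc.
have q0 := sinhc_gt0 p_gt0 ct0; have K0 := coshp_gt0 p_gt0 ct0.
move: (sinhc p _) (coshp p _) q0 K0 => q K q0 K0.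
case: p p_gt0 => // m _ /=; rewrite !exprS expr_div_n.
field.
by rewrite !lt0r_neq0 ?exprn_gt0.
Qed.

Let rate0 : mu = 0 -> c = 0.
Proof. by move=> mu0; rewrite /c mu0 powR0 ?mulr0// invr_eq0 pnatr_eq0 -lt0n. Qed.

(** [scaling_flat] and [scalingE] remove the case distinction at [0] hidden in
    [sinhc], after which [scaling] can be differentiated. *)
Lemma scaling_flat : mu = 0 -> scaling = C \*: (id : R -> R) ^+ p.
Proof.
move=> mu0; apply/funext => s.
rewrite /scaling (rate0 mu0) mul0r /sinhc eqxx expr1n mulr1.
by rewrite [RHS]/= exprfctE.
Qed.

Lemma scalingE : mu != 0 ->
  scaling = mu^-1 \*: ((sinhp p \o (c \*: id)) ^+ p : R -> R).
Proof.
move=> mu0; apply/funext => s; apply: (mulfI mu0).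
by rewrite mu_scaling /= exprfctE /GRing.scale/= mulVKf.
Qed.

Lemma is_derive_scaling (t : R) : 0 < t ->
  is_derive t 1 scaling (scaling t * (p%:R / t * cothc p (c * t))).
Proof.
move=> t0; have ct0 := ct_ge0 (ltW t0).
have [mu0|mu_neq0] := eqVneq mu 0.
  have c0 := rate0 mu0.
  rewrite [X in is_derive _ _ X](scaling_flat mu0).
  apply: (is_derive_eq (is_deriveZ C (is_deriveX p (is_derive_id t 1)))).
  rewrite /scaling c0 mul0r /cothc /tanhc /sinhc eqxx coshp0// expr1n.
  rewrite /GRing.scale/=; case: p p_gt0 => // m _ /=; rewrite exprS.
  by field; rewrite lt0r_neq0.
have mu_gt0 : 0 < mu by rewrite lt_def mu_neq0.
have c_gt0 : 0 < c by rewrite mulr_gt0 ?powR_gt0.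
have d1 := is_deriveZ c (is_derive_id t 1).
have d2 := is_derive1_comp (is_derive_sinhp p_gt0 (mulr_gt0 c_gt0 t0)) d1.
rewrite [X in is_derive _ _ X](scalingE mu_neq0).
apply: (is_derive_eq (is_deriveZ mu^-1 (is_deriveX p d2))).
apply: (mulfI mu_neq0); rewrite [in RHS]mulrA mu_scaling.
rewrite /GRing.scale/= /cothc /tanhc /sinhc (gt_eqF (mulr_gt0 c_gt0 t0)).
have q0 := sinhp_gt0 p_gt0 (mulr_gt0 c_gt0 t0).
have K0 := coshp_gt0 p_gt0 (ltW (mulr_gt0 c_gt0 t0)).
move: (sinhp p _) (coshp p _) q0 K0 => q K q0 K0.
case: p p_gt0 => // m _ /=; rewrite exprS.
by field; rewrite !lt0r_neq0.
Qed.

Lemma scaling_continuous : {within `[0, +oo[, continuous scaling}.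
Proof.
apply/continuous_within_itvcyP; split.
  move=> t; rewrite in_itv/= andbT => t0.
  apply: differentiable_continuous; apply/derivable1_diffP.
  by have [] := is_derive_scaling t0.
have cvg_id0 : s @[s --> (0 : R)^'+] --> (0 : R).
  exact/cvg_at_right_filter/cvg_id.
have cvg_Xp (g : R -> R) : g s @[s --> (0 : R)^'+] --> (0 : R) ->
    g s ^+ p @[s --> (0 : R)^'+] --> (0 : R).
  move=> g0; have gX := @continuous_cvg _ _ _ _ _ g (fun x : R => x ^+ p) 0
    (@exprn_continuous R p 0) g0.
  by rewrite expr0n gtn_eqF// in gX; exact: gX.
have cvg_Z0 (k : R) (g : R -> R) : g s @[s --> (0 : R)^'+] --> (0 : R) ->
    k * g s @[s --> (0 : R)^'+] --> (0 : R).
  move=> g0; have gM := cvgM (cvg_cst k) g0.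
  by rewrite mulr0 in gM; exact: gM.
rewrite scaling0; have [mu0|mu_neq0] := eqVneq mu 0.
  by rewrite (scaling_flat mu0); apply: cvg_Z0; rewrite exprfctE; exact: cvg_Xp.
rewrite (scalingE mu_neq0); apply: (cvg_Z0); rewrite exprfctE; apply: cvg_Xp.
have mu_gt0 : 0 < mu by rewrite lt_def mu_neq0.
have c_gt0 : 0 < c by rewrite mulr_gt0 ?powR_gt0.
have cs0 := cvg_Z0 c _ cvg_id0.
(* [sinhp] has only a right limit at [0], and [c * s] approaches [0] from the
   right since [0 < c]. *)
apply: cvg_trans (sinhp_cvg0 p_gt0) => P.
rewrite /= => SP.
have {}SP := cs0 _ SP.
change (\forall s \near (0 : R)^'+, P (sinhp p (c * s))).
near=> s.
have : 0 < c * s -> P (sinhp p (c * s)) by near: s.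
by apply; rewrite mulr_gt0.
Unshelve. all: by end_near. Qed.

End scaling.

(** * Euclidean structure and Bregman divergences *)

Section dot_facts.
Context {R : realType} {n : nat}.
Local Notation V := 'rV[R]_n.
Implicit Types u v w : V.

Lemma dotDl u v w : dot (u + v) w = dot u w + dot v w.
Proof.
by rewrite /dot -big_split/=; apply: eq_bigr => i _; rewrite mxE mulrDl.
Qed.

Lemma dotZl (a : R) u v : dot (a *: u) v = a * dot u v.
Proof. by rewrite /dot mulr_sumr; apply: eq_bigr => i _; rewrite mxE mulrA. Qed.

Lemma dotC u v : dot u v = dot v u.
Proof. by apply: eq_bigr => i _; rewrite mulrC. Qed.

Lemma dotNl u v : dot (- u) v = - dot u v.
Proof. by rewrite -scaleN1r dotZl mulN1r. Qed.

Lemma dotNr u v : dot u (- v) = - dot u v.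
Proof. by rewrite dotC dotNl dotC. Qed.

Lemma dotBl u v w : dot (u - v) w = dot u w - dot v w.
Proof. by rewrite dotDl dotNl. Qed.

Lemma dotBr u v w : dot u (v - w) = dot u v - dot u w.
Proof. by rewrite dotC dotBl !(dotC u). Qed.

Lemma dotZr (a : R) u v : dot u (a *: v) = a * dot u v.
Proof. by rewrite dotC dotZl dotC. Qed.

Lemma dot0r u : dot u 0 = 0.
Proof. by rewrite -[X in dot _ X](subrr u) dotBr subrr. Qed.

Lemma cvg_dot (T : Type) (F : set_system T) {FF : Filter F}
    (U W : T -> V) u w :
  U @ F --> u -> W @ F --> w -> dot (U s) (W s) @[s --> F] --> dot u w.
Proof.
move=> Uu Ww; rewrite /dot.
apply: cvg_big => // [|i _]; first exact: add_continuous.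
apply: cvgM.
  exact: (@cvg_comp _ _ _ U (fun M : V => M 0 i) _ _ _ Uu
    (@coord_continuous _ _ _ _ _ _)).
exact: (@cvg_comp _ _ _ W (fun M : V => M 0 i) _ _ _ Ww
    (@coord_continuous _ _ _ _ _ _)).
Qed.

Lemma diff_dot_grad (g : V -> R) x v :
  'd g x v = dot (grad g x) v.
Proof.
rewrite [X in 'd g x X]row_sum_delta linear_sum /dot.
by apply: eq_bigr => i _; rewrite linearZ /= mxE mulrC.
Qed.

Lemma is_derive_comp_grad (g : V -> R) (X : R -> V) (t : R) v :
  differentiable g (X t) -> is_derive t 1 X v ->
  is_derive t 1 (g \o X) (dot (grad g (X t)) v).
Proof.
move=> dg [dX eX].
have dX' : differentiable X t by exact/derivable1_diffP.
apply: DeriveDef.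
  by apply/derivable1_diffP; exact: differentiable_comp.
rewrite deriveE; last exact: differentiable_comp.
by rewrite diff_comp//= diff_dot_grad -eX [in RHS]deriveE.
Qed.

Lemma bregmanxx (g : V -> R) x : bregman g x x = 0.
Proof. by rewrite /bregman !subrr dot0r subrr. Qed.

Lemma bregman_three_point (g : V -> R) x y z :
  bregman g y x - bregman g y z =
    dot (grad g x - grad g z) (z - y) + bregman g z x.
Proof.
rewrite /bregman; move: (grad g x) (grad g z) => u w.
rewrite !(dotBl, dotBr); ring.
Qed.

(** Formally [z |-> bregman g y z] has differential
    [dz |-> dot (D (grad g) z dz) (z - y)], but [Z] need not be differentiable
    here, nor [g] twice so. The three-point identity gives the expected
    derivative up to the remainder [bregman g (Z t) (Z s)], and nonnegativity of
    [bregman g (Z s) (Z t)] bounds that remainder by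
    [dot (grad g (Z s) - grad g (Z t)) (Z s - Z t)], which is [o(s - t)] because
    the first factor is [O(s - t)] and [Z] is continuous. *)
Lemma is_derive_bregman (g : V -> R) (Z : R -> V) (t : R) (y w : V) :
  (forall a b, 0 <= bregman g a b) ->
  {for t, continuous Z} -> is_derive t 1 (fun s => grad g (Z s)) w ->
  is_derive t 1 (fun s => bregman g y (Z s)) (dot w (Z t - y)).
Proof.
move=> g_ge0 Zc /is_derive1_cvgP qw; apply/is_derive1_cvgP.
set q := (fun e : R => _) in qw.
have Zt : Z (e + t) @[e --> 0^'] --> Z t.
  apply: (@continuous_cvg _ _ _ _ _ (fun e : R => e + t) Z _ Zc).
  rewrite -[X in _ --> X]add0r; apply: cvgD; last exact: cvg_cst.
  by apply: cvg_within_filter; exact: cvg_id.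
pose r (e : R) := e^-1 * bregman g (Z t) (Z (e + t)).
have r0 : r e @[e --> 0^'] --> 0.
  apply/norm_cvg0P.
  apply: (@squeeze_cvgr _ _ _ _ (fun=> 0)
    (fun e => `|dot (q e) (Z (e + t) - Z t)|)).
  - near=> e; rewrite normr_ge0/= /r /q dotZl !normrM ler_wpM2l//.
    have := bregman_three_point g (Z (e + t)) (Z (e + t)) (Z t).
    rewrite bregmanxx sub0r => eB.
    have : bregman g (Z t) (Z (e + t)) <=
        dot (grad g (Z (e + t)) - grad g (Z t)) (Z (e + t) - Z t).
      rewrite -[Z (e + t) - Z t]opprB dotNr.
      move: eB (g_ge0 (Z (e + t)) (Z t)); lra.
    by move=> le_B; rewrite !ger0_norm// (le_trans _ le_B).
  - exact: cvg_cst.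
  - have Z0 : Z (e + t) - Z t @[e --> 0^'] --> Z t - Z t.
      by apply: cvgB => //; exact: cvg_cst.
    have dot0 := cvg_norm (cvg_dot qw Z0).
    by rewrite subrr dot0r normr0 in dot0; exact: dot0.
rewrite -[X in _ --> X]addr0.
have : dot (q e) (Z t - y) + r e @[e --> 0^'] --> dot w (Z t - y) + 0.
  by apply: cvgD => //; apply: cvg_dot => //; exact: cvg_cst.
apply: cvg_trans; apply: near_eq_cvg; near=> e.
by rewrite /q /r dotZl -mulrDr -bregman_three_point.
Unshelve. all: by end_near. Qed.

End dot_facts.

(** * Energy estimate *)

Lemma cvg_bregman (R : realType) (n : nat) (h : 'rV[R]_n -> R) (y z : 'rV[R]_n)
    (T : Type) (F : set_system T) {FF : Filter F} (Z : T -> 'rV[R]_n) :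
  continuously_differentiable h -> Z @ F --> z ->
  bregman h y (Z s) @[s --> F] --> bregman h y z.
Proof.
move=> [dh ch] Zz.
have hZ : h (Z s) @[s --> F] --> h z.
  exact: (continuous_cvg _ (differentiable_continuous (dh z)) Zz).
have gZ : grad h (Z s) @[s --> F] --> grad h z.
  exact: (continuous_cvg _ (ch z) Zz).
have yZ : y - Z s @[s --> F] --> y - z.
  by apply: cvgB => //; exact: cvg_cst.
apply: cvgB; last exact: cvg_dot.
by apply: cvgB => //; exact: cvg_cst.
Qed.

(** The bracket multiplying [dA] in the derivative of the energy. By the
    three-point identity it equals
    [- (bregman f y x - mu * bregman h y x) - mu * bregman h z x]. *)
Lemma energy_dissipation (R : realType) (n : nat) (mu : R)
    (f h : 'rV[R]_n -> R) x y z :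
  0 <= mu -> (forall a b, 0 <= bregman h a b) ->
  (forall a b, mu * bregman h a b <= bregman f a b) ->
  f x - f y + dot (grad f x) (z - x) + mu * bregman h y z
    + dot (mu *: grad h x - mu *: grad h z - grad f x) (z - y) <= 0.
Proof.
move=> mu0 h_ge0 f_uc.
have e3 := bregman_three_point h x y z.
have := f_uc y x; have := mulr_ge0 mu0 (h_ge0 z x).
rewrite dotBl -scalerBr dotZl.
have -> : dot (grad h x - grad h z) (z - y)
  = bregman h y x - bregman h y z - bregman h z x.
  by rewrite e3; ring.
rewrite /(bregman f); move: (grad f x) => u.
rewrite !dotBr; lra.
Qed.

(** For an arbitrary time scaling [A], the coefficients [alpha = A' / A] and
    [beta = A' / (1 + mu * A)] are those for which the cross terms in the
    derivative of the energy [E] combine into [energy_dissipation]. *)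
Lemma accelerated_flow_bound (R : realType) (n : nat) (mu : R)
    (f h : 'rV[R]_n -> R) (A dA alpha beta : R -> R) (X Z : R -> 'rV[R]_n)
    (y : 'rV[R]_n) :
  0 <= mu -> (forall x, differentiable f x) -> continuously_differentiable h ->
  (forall a b, 0 <= bregman h a b) ->
  (forall a b, mu * bregman h a b <= bregman f a b) ->
  {within `[0, +oo[, continuous A} -> A 0 = 0 ->
  (forall t : R, 0 < t -> [/\ is_derive t 1 A (dA t), 0 <= A t, 0 <= dA t,
     A t * alpha t = dA t & (1 + mu * A t) * beta t = dA t]) ->
  {within `[0, +oo[, continuous X} -> {within `[0, +oo[, continuous Z} ->
  (forall t : R, 0 < t -> is_derive t 1 X (alpha t *: (Z t - X t))) ->
  (forall t : R, 0 < t -> is_derive t 1 (fun s => grad h (Z s))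
     (beta t *: (mu *: grad h (X t) - mu *: grad h (Z t) - grad f (X t)))) ->
  forall t : R, 0 < t -> A t * (f (X t) - f y) <= bregman h y (Z 0).
Proof.
move=> mu0 df h_C1 h_ge0 f_uc Ac A0 A_spec Xc Zc dX dW t t0.
have /continuous_within_itvcyP[_ A0c] := Ac.
have /continuous_within_itvcyP[_ X0c] := Xc.
have /continuous_within_itvcyP[Zpc Z0c] := Zc.
pose E := (A * ((f \o X) - cst (f y)) +
  (cst 1 + mu \*: A) * (fun s => bregman h y (Z s)) : R -> R).
have EE (s : R) :
    E s = A s * (f (X s) - f y) + (1 + mu * A s) * bregman h y (Z s).
  by [].
have dE (s : R) : 0 < s -> exists2 e, is_derive s 1 E e & e <= 0.
  move=> s0; have [dAs As_ge0 dAs_ge0 eA eB] := A_spec _ s0.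
  have Zsc : {for s, continuous Z} by apply: Zpc; rewrite in_itv/= s0.
  have d1 := is_derive_comp_grad (df (X s)) (dX _ s0).
  have d2 := is_derive_bregman y h_ge0 Zsc (dW _ s0).
  have d3 := is_deriveB d1 (is_derive_cst (f y) s 1).
  have d4 := is_deriveD (is_derive_cst (1 : R) s 1) (is_deriveZ mu dAs).
  eexists; first exact: (is_deriveD (is_deriveM dAs d3) (is_deriveM d4 d2)).
  rewrite !dotZl !dotZr.
  have := mulr_ge0_le0 dAs_ge0 (energy_dissipation (X s) y (Z s) mu0 h_ge0 f_uc).
  apply: le_trans; rewrite le_eqVlt; apply/orP; left; apply/eqP.
  have -> : (f \o X - cst (f y)) s = f (X s) - f y by [].
  have -> : (cst 1 + mu \*: A) s = 1 + mu * A s by [].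
  rewrite [in RHS]mulrDr -[in X in _ = _ + X]eB.
  rewrite [in RHS]mulrDr [in RHS]mulrDr -[in X in _ = _ + X + _ + _]eA.
  move: (dot _ (Z s - X s)) (dot _ (Z s - y)) => u v.
  by rewrite /GRing.scale/=; ring.
have : E t <= E 0.
  apply: (@ler0_derive1_nincry R E 0 _ _ _ 0 t (lexx 0) (ltW t0)).
  - move=> s; rewrite in_itv/= andbT => /dE[e de _]; exact: ex_derive.
  - move=> s; rewrite in_itv/= andbT => /dE[e de e0].
    by rewrite derive1E; have [_ ->] := de.
  - apply/continuous_within_itvcyP; split.
      move=> s; rewrite in_itv/= andbT => /dE[e de _].
      apply: differentiable_continuous; apply/derivable1_diffP.
      by case: de.
    rewrite /E; apply: cvgD; apply: cvgM => //.
    + apply: cvgB; last exact: cvg_cst.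
      exact: (continuous_cvg _ (differentiable_continuous (df (X 0))) X0c).
    + apply: cvgD; first exact: cvg_cst.
      by apply: cvgZr.
    + exact: cvg_bregman.
rewrite !EE A0 mul0r mulr0 addr0 mul1r add0r.
have [_ At_ge0 _ _ _] := A_spec _ t0.
apply: le_trans; rewrite lerDl.
by rewrite mulr_ge0// addr_ge0// mulr_ge0.
Qed.

Unset Implicit Arguments.

Theorem corollary16 (R : realType) (n p : nat) (mu C s : R)
    (x0 xstar : 'rV[R]_n) (f h : 'rV[R]_n -> R) (X Z : R -> 'rV[R]_n)
    (p_ge2 : (2 <= p)%N) (mu_ge0 : 0 <= mu) (C_gt0 : 0 < C) (s_gt0 : 0 < s)
    (h_C1 : continuously_differentiable h)
    (f_C1 : continuously_differentiable f)
    (f_diff : times_differentiable p.-1 f)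
    (h_uc : uniformly_convex 1 p h)
    (f_uc : relatively_uniformly_convex mu h f)
    (f_smooth : smooth_of_order p.-1 (p.-1`!%:R / s) f)
    (xstar_min : forall x, f xstar <= f x)
    (flow : tensor_flow p C mu f h x0 X Z) :
  forall t : R, 0 < t ->
    f (X t) - f xstar <=
      (C * t ^+ p * sinhc p (C `^ p%:R^-1 * mu `^ p%:R^-1 * t) ^+ p)^-1
      * bregman h xstar x0.
Proof.
have p_gt0 : (0 < p)%N by exact: ltnW.
have h_ge0 a b : 0 <= bregman h a b.
  by apply: le_trans (h_uc b a); rewrite mulr_ge0 ?divr_ge0 ?exprn_ge0 ?sqrtr_ge0.
move: flow f_uc => [Xc Zc [_ Z0] dX dW] [_ f_uc] t t_gt0.
have A_gt0 := @scaling_gt0 R p C mu p_gt0 C_gt0.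
have bound := accelerated_flow_bound (A := scaling p C mu) xstar mu_ge0 f_C1.1
  h_C1 h_ge0 f_uc (scaling_continuous p_gt0 C_gt0 mu_ge0) (scaling0 C mu p_gt0)
  _ Xc Zc dX dW t_gt0.
rewrite mulrC ler_pdivlMr; last exact: A_gt0.
rewrite mulrC -Z0; apply: bound => r r_gt0.
have Ar_gt0 := A_gt0 _ r_gt0.
have a_gt0 := scaling_cothc_gt0 C mu p_gt0 r_gt0.
split; [exact: is_derive_scaling | exact: ltW | | reflexivity |
  exact: scaling_tanhc].
exact: (ltW (mulr_gt0 Ar_gt0 a_gt0)).
Qed.
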